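(* Let $L\geq 1$ be an integer, let $\mathbf{p}_L=(p_1,\ldots,p_L)$ with $p_i\geq 0$ and $p_{>L}=1-\sum_{i=1}^L p_i>0$, and let $\mu\in(0,\infty)$ be such that the class $\mathcal{F}(\mu,\mathbf{p}_L)$ is non-empty. Let $G=G(\mathbf{p}_L)$ and $H=H(\mu,\mathbf{p}_L)$ be the distributions defined in the context. (a) If $\tilde z_G\leq e^{-\frac{1}{L+1}}$, then $$\xi_F\geq 1-g_G\bigl(\tilde z_G^{(\mu)}\bigr)\qquad\text{for all }F\in\mathcal{F}(\mu,\mathbf{p}_L),$$ where $\tilde z_G^{(\mu)}$ is the smallest non-negative solution of the equation $s=g_G'(s)/\mu$. (b) If $\tilde z_H\leq e^{-\frac{2}{L+1}}$, then $$\xi_F\leq \xi_H\qquad\text{for all }F\in\mathcal{F}(\mu,\mathbf{p}_L).$$ Moreover, the bounds are optimal under the given conditions: under the condition in (a), $\inf_{F\in\mathcal{F}(\mu,\mathbf{p}_L)}\xi_F=1-g_G\bigl(\tilde z_G^{(\mu)}\bigr)$, and under the condition in (b), $\sup_{F\in\mathcal{F}(\mu,\mathbf{p}_L)}\xi_F=\xi_H$.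
   Context: All degree distributions $F=\{p_d\}_{d\geq 0}$ are probability distributions on the non-negative integers with $p_0=0$, with finite mean, and, for the distributions in the class below, with $p_2\neq 1$. For such an $F$ with $D\sim F$, write $\mu_F=\mathbb{E}[D]=\sum_d d\,p_d$ and $g_F(s)=\sum_{d}p_d s^d$ for $s\in[0,1]$. The down-shifted size-biased version $\tilde F=\{\tilde p_d\}_{d\geq 0}$ of $F$ is $\tilde p_d=(d+1)p_{d+1}/\mu_F$; its probability generating function is $g_F'(s)/\mu_F$. Let $\tilde z_F$ be the extinction probability of a (Galton–Watson) branching process with offspring distribution $\tilde F$, that is, the smallest non-negative solution of $s=g_F'(s)/\mu_F$. The size of the giant component is $$\xi_F=1-g_F(\tilde z_F),$$ which is the asymptotic fraction of vertices in the largest component of the configuration model with i.i.d. degrees distributed as $F$. The quantities $g_G,\tilde z_G$ and $g_H,\tilde z_H,\xi_H$ are given by the same formulas for the distributions $G$ and $H$ below, each with its own mean (so $\tilde z_G$ is the smallest non-negative solution of $s=g_G'(s)/\mu_G$ with $\mu_G$ the mean of $G$, whereas $\tilde z_G^{(\mu)}$ in the claim uses $\mu$ in place of $\mu_G$). $\mathcal{F}(\mu,\mathbf{p}_L)$ denotes the set of all probability distributions on the non-negative integers that assign probability $0$ to the integer $0$, do not assign probability $1$ to the integer $2$, have (finite) mean $\mu$, and whose probabilities of the degrees $1,\ldots,L$ are exactly $p_1,\ldots,p_L$. $G=G(\mathbf{p}_L)$ is the distribution assigning probability $p_d$ to $d\in\{1,\ldots,L\}$, probability $p_{>L}$ to $L+1$,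 and $0$ to all other integers. Set $\kappa=\frac{1}{p_{>L}}\bigl(\mu-\sum_{d=1}^L d\,p_d\bigr)$; for every $F\in\mathcal{F}(\mu,\mathbf{p}_L)$ and $D\sim F$ one has $\mathbb{E}[D\mid D>L]=\kappa$. $H=H(\mu,\mathbf{p}_L)$ is the distribution assigning probability $p_d$ to $d\in\{1,\ldots,L\}$, probability $(\lfloor\kappa\rfloor+1-\kappa)\,p_{>L}$ to $\lfloor\kappa\rfloor$, probability $(\kappa-\lfloor\kappa\rfloor)\,p_{>L}$ to $\lfloor\kappa\rfloor+1$, and $0$ to all other integers; it has mean $\mu$. *)

(* Defs.v *)
From Stdlib Require Import Reals Lra Lia ClassicalEpsilon FunctionalExtensionality.
From Coquelicot Require Import Coquelicot.
Open Scope R_scope.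

(** * Distributions on the non-negative integers, as mass functions [nat -> R] *)

Definition is_distr (F : nat -> R) : Prop :=
  (forall d, 0 <= F d) /\ is_series F 1.

Definition has_mean (F : nat -> R) (m : R) : Prop :=
  is_series (fun d => INR d * F d) m.

Definition mean (F : nat -> R) : R := Series (fun d => INR d * F d).

Definition pgf (F : nat -> R) (s : R) : R := PSeries F s.

(** [g_F'] is the termwise derivative of the power series. It agrees with
    [Derive (pgf F)] on [(-1, 1)] (lemma [Derive_pgf]); at [s = 1] it is the
    left derivative [sum_d d p_d], where the two-sided [Derive] need not be
    meaningful because the series may diverge beyond [1]. *)
Definition dpgf (F : nat -> R) (s : R) : R := PSeries (PS_derive F) s.

Definition size_biased (F : nat -> R) (d : nat) : R :=
  INR (S d) * F (S d) / mean F.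

(** * Smallest non-negative solution of [s = f s] *)

Definition is_smallest_solution (f : R -> R) (z : R) : Prop :=
  0 <= z /\ z = f z /\ forall s, 0 <= s -> s = f s -> z <= s.

(** Arbitrary if there is no smallest solution. There is one for [z_tilde F]
    whenever [F] has a positive finite mean (lemma [z_tilde_spec]); and there is
    one for [s = g_G'(s) / mu] by [smallest_solution_monotone], because
    [mean G <= mu] when the class is non-empty. A generating function may diverge
    at [s > 1] (where [PSeries] has no meaning), but this is harmless, since in
    these cases there is a solution in [[0, 1]]. *)
Definition smallest_solution (f : R -> R) : R :=
  epsilon (inhabits 0) (is_smallest_solution f).

Definition extinction_prob (q : nat -> R) : R := smallest_solution (pgf q).

Definition z_tilde (F : nat -> R) : R := extinction_prob (size_biased F).

(** Size of the giant component. *)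
Definition xi (F : nat -> R) : R := 1 - pgf F (z_tilde F).

(** * The class F(mu, p_L) and the distributions G and H *)

(** The vector [(p_1, ..., p_L)] is given by a function [p : nat -> R] of which
    only the values at [1, ..., L] are used. *)

Definition p_gt (L : nat) (p : nat -> R) : R := 1 - sum_n_m p 1 L.

Definition degree_class (mu : R) (L : nat) (p : nat -> R) (F : nat -> R) : Prop :=
  is_distr F /\ F 0%nat = 0 /\ F 2%nat <> 1 /\ has_mean F mu /\
  forall i, (1 <= i <= L)%nat -> F i = p i.

Definition G_dist (L : nat) (p : nat -> R) (d : nat) : R :=
  if Nat.eqb d 0 then 0
  else if Nat.leb d L then p d
  else if Nat.eqb d (L + 1) then p_gt L p
  else 0.

(** The constant [z_G^(mu)]: the given mean [mu] is used instead of [mean G]. *)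
Definition z_tilde_G_mu (mu : R) (L : nat) (p : nat -> R) : R :=
  smallest_solution (fun s => dpgf (G_dist L p) s / mu).

Definition kappa (mu : R) (L : nat) (p : nat -> R) : R :=
  (mu - sum_n_m (fun d => INR d * p d) 1 L) / p_gt L p.

(** If the class is non-empty then [kappa >= L + 1], so the cases below do not
    overlap. [Int_part] is the floor. *)
Definition H_dist (mu : R) (L : nat) (p : nat -> R) (d : nat) : R :=
  let k := kappa mu L p in
  let fl := Int_part k in
  if Nat.eqb d 0 then 0
  else if Nat.leb d L then p d
  else if Z.eqb (Z.of_nat d) fl then (IZR fl + 1 - k) * p_gt L p
  else if Z.eqb (Z.of_nat d) (fl + 1) then (k - IZR fl) * p_gt L p
  else 0.

(** * Adequacy of the definitions *)

Lemma smallest_solutionP (f : R -> R) :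
  (exists z, is_smallest_solution f z) ->
  is_smallest_solution f (smallest_solution f).
Proof. intros H; unfold smallest_solution; now apply epsilon_spec. Qed.

Lemma smallest_solution_ext (f g : R -> R) :
  (forall s, f s = g s) -> smallest_solution f = smallest_solution g.
Proof.
intros E; unfold smallest_solution; f_equal.
now rewrite (functional_extensionality f g E).
Qed.

Lemma smallest_solution_monotone (f : R -> R) :
  (forall s, 0 <= s <= 1 -> 0 <= f s) ->
  (forall s t, 0 <= s -> s <= t -> t <= 1 -> f s <= f t) ->
  f 1 <= 1 ->
  is_smallest_solution f (smallest_solution f) /\ smallest_solution f <= 1.
Proof.
intros f0 fmono f1.
set (E := fun s => 0 <= s <= 1 /\ f s <= s).
assert (E1 : E 1) by (split; lra).
destruct (ex_glb_Rbar E) as [m [mlb mglb]].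
assert (m_le : Rbar_le m 1) by (apply mlb; exact E1).
assert (m_ge : Rbar_le 0 m) by (apply mglb; intros s [[Hs _] _]; exact Hs).
destruct m as [m| |]; simpl in m_le, m_ge; try easy.
assert (fm : f m <= m).
{ change (Rbar_le (f m) m). apply mglb. intros s Es.
  assert (ms : m <= s) by exact (mlb s Es). destruct Es as [Hs fs]; simpl.
  apply Rle_trans with (f s); [apply fmono; lra | exact fs]. }
assert (fm0 : 0 <= f m) by (apply f0; lra).
assert (mf : m <= f m).
{ apply (mlb (f m)); split; [lra | apply fmono; lra]. }
assert (Hm : is_smallest_solution f m).
{ split; [lra | split; [lra |]]. intros s s0 Hs.
  destruct (Rle_dec s 1); [|lra]. apply (mlb s); split; lra. }
assert (HS := smallest_solutionP f (ex_intro _ m Hm)).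
split; [exact HS |].
apply Rle_trans with m; [|lra]. apply HS; lra.
Qed.

Lemma ex_pgf_nonneg (a : nat -> R) (s : R) :
  (forall n, 0 <= a n) -> ex_series a -> 0 <= s <= 1 ->
  ex_series (fun n => a n * s ^ n).
Proof.
intros a0 exa Hs. apply (@ex_series_le R_AbsRing R_CompleteNormedModule _ a); [|exact exa].
intros n. change (Rabs (a n * s ^ n) <= a n).
assert (s ^ n <= 1) by (rewrite <- (pow1 n); apply pow_incr; lra).
assert (0 <= s ^ n) by (apply pow_le; lra).
assert (h := a0 n). rewrite Rabs_pos_eq; nra.
Qed.

Lemma smallest_solution_pgf (a : nat -> R) :
  (forall n, 0 <= a n) -> ex_series a -> Series a <= 1 ->
  is_smallest_solution (pgf a) (smallest_solution (pgf a)) /\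
  smallest_solution (pgf a) <= 1.
Proof.
intros a0 exa a1.
assert (mono : forall s t, 0 <= s -> s <= t -> t <= 1 -> pgf a s <= pgf a t).
{ intros s t s0 st t1. apply Series_le.
  - intros n; split.
    + apply Rmult_le_pos; [apply a0 | apply pow_le; lra].
    + apply Rmult_le_compat_l; [apply a0 | apply pow_incr; lra].
  - apply ex_pgf_nonneg; try assumption; lra. }
apply smallest_solution_monotone; [| exact mono |].
- intros s Hs. apply Rle_trans with (pgf a 0); [|apply mono; lra].
  unfold pgf; rewrite PSeries_0; apply a0.
- unfold pgf, PSeries; rewrite (Series_ext _ a); [exact a1|].
  intros n; rewrite pow1; ring.
Qed.

Lemma pgf_size_biased (F : nat -> R) (s : R) :
  pgf (size_biased F) s = dpgf F s / mean F.
Proof.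
unfold pgf, dpgf, PSeries, Rdiv. rewrite <- Series_scal_r. apply Series_ext.
intros n; unfold size_biased, PS_derive, Rdiv; ring.
Qed.

Lemma z_tildeE (F : nat -> R) :
  z_tilde F = smallest_solution (fun s => dpgf F s / mean F).
Proof. apply smallest_solution_ext; intros s; apply pgf_size_biased. Qed.

Lemma ex_PS_derive (F : nat -> R) (m : R) :
  has_mean F m -> is_series (PS_derive F) m.
Proof.
intros HF. unfold has_mean in HF.
apply is_series_ext with (fun n => INR (S n) * F (S n)); [easy|].
apply (is_series_incr_1 (fun d => INR d * F d)).
replace (plus _ _) with m; [exact HF|].
change (m = m + 0 * F 0%nat); ring.
Qed.

Lemma z_tilde_spec (F : nat -> R) (m : R) :
  is_distr F -> has_mean F m -> 0 < m ->
  is_smallest_solution (fun s => dpgf F s / mean F) (z_tilde F) /\ z_tilde F <= 1.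
Proof.
intros [F0 _] Fm m0.
assert (HS := is_series_scal_r (/ m) _ _ (ex_PS_derive F m Fm)).
assert (mE : mean F = m) by (apply is_series_unique; exact Fm).
assert (HS' : is_series (size_biased F) 1).
{ replace 1 with (m * / m) by (field; lra).
  apply is_series_ext with (2 := HS).
  intros n; unfold size_biased; rewrite mE; reflexivity. }
replace (fun s => dpgf F s / mean F) with (pgf (size_biased F)).
2: apply functional_extensionality; apply pgf_size_biased.
apply smallest_solution_pgf.
- intros n; unfold size_biased; rewrite mE.
  apply Rmult_le_pos; [apply Rmult_le_pos; [apply pos_INR | apply F0] |].
  apply Rlt_le, Rinv_0_lt_compat, m0.
- exists 1; exact HS'.
- rewrite (is_series_unique _ _ HS'); lra.
Qed.

Lemma Derive_pgf (F : nat -> R) (s : R) :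
  is_distr F -> Rabs s < 1 -> Derive (pgf F) s = dpgf F s.
Proof.
intros [F0 F1] Hs. unfold pgf. apply Derive_PSeries.
apply Rbar_lt_le_trans with (Finite 1); [exact Hs|].
unfold CV_radius, Lub_Rbar.
destruct (ex_lub_Rbar (CV_disk F)) as [l [ub lub]]; simpl.
apply ub. unfold CV_disk.
apply ex_series_ext with F; [|exists 1; exact F1].
intros n; rewrite pow1, Rmult_1_r, Rabs_pos_eq; [reflexivity | apply F0].
Qed.

(* Main.v *)
Require Import Defs.
From Stdlib Require Import Reals Lra Lia.
From Coquelicot Require Import Coquelicot.
Open Scope R_scope.

(** For fixed [s], both [g_F(s)] and [g_F'(s)] are expectations under [F], of the
    sequences [s^d] and [d s^(d-1)]. Two members of the class differ only above
    [L], where they have the same total mass and the same mean, so such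
    expectations can be compared by subtracting an affine function of [d]; for
    the comparison with [G], whose mean is different, a constant is subtracted
    ([expectation_le]).

    Lower bound. If [s <= exp (-1/(L+1))], then [s^d] and [d s^(d-1)] both decrease
    for [d >= L + 1] ([deriv_pow_decreasing]), so [g_F <= g_G] and [g_F' <= g_G'] at
    [s] ([expectation_le_G]). At [s = z], the smallest solution of
    [s = g_G'(s) / mu], the second inequality gives [g_F'(z) / mu <= z], hence
    [z_F <= z] and [g_F(z_F) <= g_F(z) <= g_G(z)] ([xi_lower_bound]).
    The bound is approached by the distributions obtained from [G] by moving a
    small mass from [L + 1] to a far atom so that the mean becomes [mu]
    ([exists_near_G]). Their generating functions and the derivatives of these
    are bounded below by those of [G] up to a uniformly small error, and convexity
    of [g_G'] shows that [z_F] is then not much below [z] ([xi_lower_bound_sharp]).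

    Upper bound. If [s <= exp (-2/(L+1))], then [d s^(d-1)] is convex in
    [d >= L + 1] ([deriv_pow_convex]), as is [s^d]. Comparing with the line through
    the values at [floor kappa] and [floor kappa + 1], the two atoms of [H] above
    [L], gives [g_H <= g_F] and [g_H' <= g_F'] at [s] ([expectation_H_le]). Hence
    [z_H <= z_F], as otherwise [g_H'(z_F) / mu <= z_F < z_H], and
    [g_H(z_H) <= g_F(z_H) <= g_F(z_F)] ([xi_upper_bound]). The bound is attained,
    since [H] belongs to the class ([H_distE]). *)

(** * Series of real numbers *)

(** The equalities of terms in this lemma and the next are stated in [R] itself,
    where [ring] applies, and not in the carrier of a structure on [R]. *)
Lemma is_series_ext_R (a b : nat -> R) (l : R) :
  (forall n, a n = b n) -> is_series a l -> is_series b l.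
Proof. exact (is_series_ext a b l). Qed.

Lemma sum_n_m_ext_R (a b : nat -> R) (n m : nat) :
  (forall d, a d = b d) -> sum_n_m a n m = sum_n_m b n m.
Proof. exact (sum_n_m_ext a b n m). Qed.

Lemma is_series_le (a b : nat -> R) (la lb : R) :
  (forall n, a n <= b n) -> is_series a la -> is_series b lb -> la <= lb.
Proof.
intros ab Ha Hb.
apply (is_lim_seq_le (sum_n a) (sum_n b) la lb); [|exact Ha|exact Hb].
intros n; now apply sum_n_m_le.
Qed.

Lemma is_series_point (j : nat) (c : R) :
  is_series (fun d => if Nat.eqb d j then c else 0) c.
Proof.
set (a := fun d => if Nat.eqb d j then c else 0).
assert (S0 : forall n, sum_n a n = if Nat.leb j n then c else 0).
{ induction n as [|n IH].
  - rewrite sum_O; unfold a; destruct j; reflexivity.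
  - rewrite sum_Sn, IH; unfold a; change plus with Rplus.
    destruct (Nat.eqb_spec (S n) j), (Nat.leb_spec j n), (Nat.leb_spec j (S n));
      try lia; lra. }
apply (is_lim_seq_ext_loc (fun _ => c) (sum_n a) c); [|apply is_lim_seq_const].
exists j; intros n Hn; rewrite S0.
destruct (Nat.leb_spec j n); [reflexivity | lia].
Qed.

Lemma is_series_head (b : nat -> R) (L : nat) :
  is_series (fun d => if andb (Nat.leb 1 d) (Nat.leb d L) then b d else 0)
    (sum_n_m b 1 L).
Proof.
induction L as [|L IH].
- rewrite sum_n_m_zero by lia.
  apply is_series_ext_R with (2 := is_series_point 0 0).
  intros [|d]; simpl; [reflexivity|]. now destruct d.
- rewrite sum_n_Sm by lia.
  apply is_series_ext
    with (2 := is_series_plus _ _ _ _ IH (is_series_point (S L) (b (S L)))).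
  intros d; change plus with Rplus.
  destruct (Nat.leb_spec 1 d), (Nat.leb_spec d L), (Nat.leb_spec d (S L)),
    (Nat.eqb_spec d (S L)); subst; simpl; try lia; lra.
Qed.

(** * Comparison of expectations *)

(** Subtracting an affine function [alpha + beta * d] changes the expectations
    under [F] and [T] by the same amount, provided that the means agree
    or [beta = 0]. *)
Lemma expectation_le (F T a : nat -> R) (m m' u v alpha beta : R) :
  is_distr F -> has_mean F m -> is_distr T -> has_mean T m' ->
  beta * m = beta * m' ->
  is_series (fun d => F d * a d) u -> is_series (fun d => T d * a d) v ->
  (forall d, F d * (a d - (alpha + beta * INR d)) <=
             T d * (a d - (alpha + beta * INR d))) ->
  u <= v.
Proof.
intros [_ F1] Fm [_ T1] Tm mm Fa Ta le.
assert (shift : forall (X : nat -> R) n w, is_series X 1 ->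
  is_series (fun d => INR d * X d) n -> is_series (fun d => X d * a d) w ->
  is_series (fun d => X d * (a d - (alpha + beta * INR d)))
    (w - (alpha * 1 + beta * n))).
{ intros X n w X1 Xm Xa.
  apply is_series_ext_R with (2 := is_series_minus _ _ _ _ Xa
    (is_series_plus _ _ _ _ (is_series_scal_l alpha _ _ X1)
       (is_series_scal_l beta _ _ Xm))).
  intros d; change (X d * a d - (alpha * X d + beta * (INR d * X d)) =
    X d * (a d - (alpha + beta * INR d))); ring. }
assert (h := is_series_le _ _ _ _ le (shift F m u F1 Fm Fa) (shift T m' v T1 Tm Ta)).
lra.
Qed.

(** * Generating functions on the unit interval *)

Lemma pow_01 (s : R) (n : nat) : 0 <= s <= 1 -> 0 <= s ^ n <= 1.
Proof.
intros Hs; split; [apply pow_le; lra|].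
rewrite <- (pow1 n); apply pow_incr; lra.
Qed.

Lemma is_series_pgf (F : nat -> R) (s : R) :
  is_distr F -> 0 <= s <= 1 -> is_series (fun d => F d * s ^ d) (pgf F s).
Proof.
intros [F0 F1] Hs. apply Series_correct, ex_pgf_nonneg; try assumption.
now exists 1.
Qed.

Lemma is_series_dpgf (F : nat -> R) (m s : R) :
  is_distr F -> has_mean F m -> 0 <= s <= 1 ->
  is_series (fun d => F d * (INR d * s ^ pred d)) (dpgf F s).
Proof.
intros [F0 F1] Fm Hs.
apply is_series_decr_1.
apply is_series_ext_R with (fun n => PS_derive F n * s ^ n).
{ intros n; unfold PS_derive; simpl pred; ring. }
replace (plus _ _) with (dpgf F s).
2: { change (dpgf F s = dpgf F s + - (F 0%nat * (0 * 1))); ring. }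
apply Series_correct, ex_pgf_nonneg; [| |exact Hs].
- intros n; apply Rmult_le_pos; [apply pos_INR | apply F0].
- exists m; now apply ex_PS_derive.
Qed.

Lemma pgf_le (F : nat -> R) (s t : R) :
  is_distr F -> 0 <= s -> s <= t -> t <= 1 -> pgf F s <= pgf F t.
Proof.
intros HF s0 st t1.
apply (is_series_le (fun d => F d * s ^ d) (fun d => F d * t ^ d));
  try (apply is_series_pgf; trivial; lra).
intros d; apply Rmult_le_compat_l; [apply HF | apply pow_incr; lra].
Qed.

Lemma dpgf_le (F : nat -> R) (m s t : R) :
  is_distr F -> has_mean F m -> 0 <= s -> s <= t -> t <= 1 -> dpgf F s <= dpgf F t.
Proof.
intros HF Fm s0 st t1.
apply (is_series_le (fun d => F d * (INR d * s ^ pred d))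
  (fun d => F d * (INR d * t ^ pred d)));
  try (apply is_series_dpgf with m; trivial; lra).
intros d; apply Rmult_le_compat_l; [apply HF|].
apply Rmult_le_compat_l; [apply pos_INR | apply pow_incr; lra].
Qed.

Lemma dpgf_ge0 (F : nat -> R) (m s : R) :
  is_distr F -> has_mean F m -> 0 <= s <= 1 -> 0 <= dpgf F s.
Proof.
intros HF Fm Hs.
apply (is_series_le (fun _ => 0) (fun d => F d * (INR d * s ^ pred d))).
- intros d; apply Rmult_le_pos; [apply HF|].
  apply Rmult_le_pos; [apply pos_INR | now apply pow_01].
- apply is_series_ext_R with (2 := is_series_point 0 0).
  intros d; now destruct (Nat.eqb d 0).
- apply is_series_dpgf with m; trivial.
Qed.

Lemma dpgf_1 (F : nat -> R) (m : R) : has_mean F m -> dpgf F 1 = m.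
Proof.
intros Fm; unfold dpgf, PSeries; apply is_series_unique.
apply is_series_ext_R with (2 := ex_PS_derive F m Fm).
intros n; rewrite pow1; ring.
Qed.

Lemma pow_lipschitz (s t : R) (n : nat) :
  0 <= s -> s <= t -> t <= 1 -> t ^ n - s ^ n <= INR n * (t - s).
Proof.
intros s0 st t1; induction n as [|n IH]; [simpl; lra|].
rewrite S_INR; simpl pow.
assert (h := pow_01 t n ltac:(lra)).
assert (h' := pow_01 s n ltac:(lra)).
assert (h'' : 0 <= INR n * (t - s)) by (apply Rmult_le_pos; [apply pos_INR | lra]).
replace (t * t ^ n - s * s ^ n) with ((t - s) * t ^ n + s * (t ^ n - s ^ n)) by ring.
nra.
Qed.

Lemma pgf_lipschitz (F : nat -> R) (m s t : R) :
  is_distr F -> has_mean F m -> 0 <= s -> s <= t -> t <= 1 ->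
  pgf F t - pgf F s <= m * (t - s).
Proof.
intros HF Fm s0 st t1.
assert (h : is_series (fun d => minus (F d * t ^ d) (F d * s ^ d))
  (minus (pgf F t) (pgf F s)))
  by (apply (is_series_minus (K := R_AbsRing) (V := R_NormedModule));
      apply is_series_pgf; trivial; lra).
assert (h' := is_series_scal_l (t - s) _ _ Fm).
rewrite (Rmult_comm m).
apply (is_series_le _ _ _ _) with (2 := h) (3 := h').
intros d; change (F d * t ^ d - F d * s ^ d <= (t - s) * (INR d * F d)).
assert (pl := pow_lipschitz s t d s0 st t1).
assert (F0 := proj1 HF d). nra.
Qed.

Lemma pow_convex (s t z : R) (n : nat) :
  0 <= s -> s <= t -> t <= z ->
  (z - s) * t ^ n <= (z - t) * s ^ n + (t - s) * z ^ n.
Proof.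
intros s0 st tz; induction n as [|n IH]; [simpl; lra|].
simpl pow.
assert (sz : s ^ n <= z ^ n) by (apply pow_incr; lra).
assert (h := Rmult_le_compat_l t _ _ ltac:(lra) IH).
assert (h' : 0 <= (z - t) * (t - s) * (z ^ n - s ^ n))
  by (repeat apply Rmult_le_pos; lra).
nra.
Qed.

Lemma dpgf_convex (F : nat -> R) (m s t z : R) :
  is_distr F -> has_mean F m -> 0 <= s -> s <= t -> t <= z -> z <= 1 ->
  (z - s) * dpgf F t <= (z - t) * dpgf F s + (t - s) * dpgf F z.
Proof.
intros HF Fm s0 st tz z1.
assert (h := fun r Hr => is_series_dpgf F m r HF Fm Hr).
apply (is_series_le _ _ _ _) with
  (2 := is_series_scal_l (z - s) _ _ (h t ltac:(lra)))
  (3 := is_series_plus _ _ _ _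
          (is_series_scal_l (z - t) _ _ (h s ltac:(lra)))
          (is_series_scal_l (t - s) _ _ (h z ltac:(lra)))).
intros d; change ((z - s) * (F d * (INR d * t ^ pred d)) <=
  (z - t) * (F d * (INR d * s ^ pred d)) + (t - s) * (F d * (INR d * z ^ pred d))).
assert (c := pow_convex s t z (pred d) s0 st tz).
assert (w : 0 <= F d * INR d) by (apply Rmult_le_pos; [apply HF | apply pos_INR]).
assert (h' := Rmult_le_compat_l _ _ _ w c). lra.
Qed.

(** * Smallest solutions *)

(** A monotone non-negative map that sends [t] below itself has a fixed point in
    the interval from 0 to [t]. *)
Lemma smallest_solution_le (f : R -> R) (z t : R) :
  is_smallest_solution f z -> 0 <= t ->
  (forall s, 0 <= s <= t -> 0 <= f s) ->
  (forall r s, 0 <= r -> r <= s -> s <= t -> f r <= f s) ->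
  f t <= t -> z <= t.
Proof.
intros [_ [_ zmin]] [t0 | <-] f0 fmono ft.
2: { apply zmin; [lra|]. assert (h := f0 0 ltac:(lra)); lra. }
(* The fixed points of f in [0, t] are those of a map of [0, 1], after scaling by t. *)
destruct (smallest_solution_monotone (fun u => f (t * u) / t))
  as [[u0 [uE _]] u1].
- intros u Hu. apply Rmult_le_pos; [apply f0; nra|].
  now apply Rlt_le, Rinv_0_lt_compat.
- intros u v u0 uv v1. apply Rmult_le_compat_r.
  + now apply Rlt_le, Rinv_0_lt_compat.
  + apply fmono; nra.
- rewrite Rmult_1_r. apply Rle_div_l; lra.
- set (u := smallest_solution _) in *.
  apply Rle_trans with (t * u); [|nra].
  apply zmin; [nra|]. rewrite uE at 1. field; lra.
Qed.

Lemma dpgf_solution_le (F : nat -> R) (m c z t : R) :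
  is_distr F -> has_mean F m -> 0 < c ->
  is_smallest_solution (fun s => dpgf F s / c) z ->
  0 <= t <= 1 -> dpgf F t / c <= t -> z <= t.
Proof.
intros HF Fm c0 Hz Ht ft.
assert (ic : 0 <= / c) by now apply Rlt_le, Rinv_0_lt_compat.
apply (smallest_solution_le _ z t Hz); [lra| | |exact ft].
- intros s Hs; apply Rmult_le_pos; [|exact ic].
  apply dpgf_ge0 with m; trivial; lra.
- intros r s r0 rs st; apply Rmult_le_compat_r; [exact ic|].
  apply dpgf_le with m; trivial; lra.
Qed.

Lemma z_tilde_le (F : nat -> R) (m t : R) :
  is_distr F -> has_mean F m -> 0 < m -> 0 <= t <= 1 ->
  dpgf F t <= m * t -> z_tilde F <= t.
Proof.
intros HF Fm m0 Ht ft.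
destruct (z_tilde_spec F m HF Fm m0) as [Hz _].
rewrite (is_series_unique _ _ Fm : mean F = m) in Hz.
apply (dpgf_solution_le F m m _ t HF Fm m0 Hz Ht).
apply Rle_div_l; lra.
Qed.

Lemma z_tilde_fix (F : nat -> R) (m : R) :
  is_distr F -> has_mean F m -> 0 < m ->
  0 <= z_tilde F <= 1 /\ dpgf F (z_tilde F) = m * z_tilde F.
Proof.
intros HF Fm m0.
destruct (z_tilde_spec F m HF Fm m0) as [[z0 [zE _]] z1].
rewrite (is_series_unique _ _ Fm : mean F = m) in zE.
split; [lra|]. rewrite zE at 2. field; lra.
Qed.

(** * Monotone and convex sequences *)

Lemma decreasing_from (a : nat -> R) (j d : nat) :
  (forall e, (j <= e)%nat -> a (S e) <= a e) -> (j <= d)%nat -> a d <= a j.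
Proof.
intros h jd; induction jd as [|d jd IH]; [lra|].
apply Rle_trans with (a d); auto.
Qed.

Lemma convex_supporting_line (a : nat -> R) (j k d : nat) :
  (forall e, (j <= e)%nat -> a (S e) - a e <= a (S (S e)) - a (S e)) ->
  (j <= k)%nat -> (j <= d)%nat ->
  a k + (a (S k) - a k) * (INR d - INR k) <= a d.
Proof.
intros cvx jk jd.
destruct (Nat.le_ge_cases k d) as [kd | dk].
- assert (slope : forall e, (k <= e)%nat -> a (S k) - a k <= a (S e) - a e).
  { intros e ke; induction ke as [|e ke IH]; [lra|].
    apply Rle_trans with (1 := IH), cvx; lia. }
  induction kd as [|d kd IH]; [lra|].
  rewrite S_INR. assert (h := slope d kd). specialize (IH ltac:(lia)). lra.
- induction dk as [|k dk IH]; [lra|].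
  rewrite S_INR. specialize (IH ltac:(lia)). assert (h := cvx k ltac:(lia)).
  assert (INR d <= INR k) by now apply le_INR.
  nra.
Qed.

Lemma pow_decreasing (s : R) (d : nat) : 0 <= s <= 1 -> s ^ S d <= s ^ d.
Proof. intros Hs; simpl; assert (h := pow_01 s d Hs); nra. Qed.

Lemma pow_seq_convex (s : R) (d : nat) :
  0 <= s -> s ^ S d - s ^ d <= s ^ S (S d) - s ^ S d.
Proof.
intros Hs; simpl; assert (h := pow_le s d Hs).
assert (h' : 0 <= s ^ d * (1 - s) ^ 2) by (apply Rmult_le_pos; [exact h | apply pow2_ge_0]).
nra.
Qed.

(** From [1 + c/x <= exp (c/x)]; it turns the exponential conditions on [s] into
    rational ones. *)
Lemma exp_bound (s c x : R) :
  0 <= s -> 0 < x -> s <= exp (- (c / x)) -> s * (x + c) <= x.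
Proof.
intros s0 x0 hs.
assert (h : s * (1 + c / x) <= 1).
{ assert (e := exp_ineq1_le (c / x)).
  assert (e' : exp (- (c / x)) * exp (c / x) = 1)
    by (rewrite <- exp_plus, <- exp_0; f_equal; ring).
  assert (ep := exp_pos (c / x)).
  apply Rle_trans with (s * exp (c / x)); [now apply Rmult_le_compat_l|].
  rewrite <- e'; apply Rmult_le_compat_r; lra. }
replace (s * (x + c)) with (x * (s * (1 + c / x))) by (field; lra).
nra.
Qed.

(** This is [(d + 1) s <= d], for which [s <= (L + 1) / (L + 2)] suffices. *)
Lemma deriv_pow_decreasing (s : R) (L d : nat) :
  0 <= s <= 1 -> s <= exp (- (1 / INR (L + 1))) -> (L + 1 <= d)%nat ->
  INR (S d) * s ^ pred (S d) <= INR d * s ^ pred d.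
Proof.
intros Hs he Ld.
destruct d as [|d]; [lia|]. simpl pred.
assert (Lp : 0 < INR (L + 1)) by (apply lt_0_INR; lia).
assert (hb := exp_bound s 1 _ (proj1 Hs) Lp he).
apply le_INR in Ld. rewrite (S_INR (S d)). simpl pow.
assert (h := pow_01 s d Hs).
assert (k : (INR (S d) + 1) * s <= INR (S d)) by nra.
assert (h' := Rmult_le_compat_r _ _ _ (proj1 h) k). lra.
Qed.

(** The second difference of [d s^(d-1)] is [s^(d-1) (1 - s) (d - (d + 2) s)], which
    is non-negative as soon as [s <= (L + 1) / (L + 3)]. *)
Lemma deriv_pow_convex (s : R) (L d : nat) :
  0 <= s <= 1 -> s <= exp (- (2 / INR (L + 1))) -> (L + 1 <= d)%nat ->
  INR (S d) * s ^ pred (S d) - INR d * s ^ pred d <=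
  INR (S (S d)) * s ^ pred (S (S d)) - INR (S d) * s ^ pred (S d).
Proof.
intros Hs he Ld.
destruct d as [|d]; [lia|]. simpl pred.
assert (Lp : 0 < INR (L + 1)) by (apply lt_0_INR; lia).
assert (hb := exp_bound s 2 _ (proj1 Hs) Lp he).
apply le_INR in Ld. rewrite (S_INR (S (S d))), (S_INR (S d)). simpl pow.
assert (h := pow_01 s d Hs).
assert (k : 0 <= (1 - s) * (INR (S d) - (INR (S d) + 2) * s))
  by (apply Rmult_le_pos; nra).
assert (h' := Rmult_le_pos _ _ (proj1 h) k). lra.
Qed.

(** * Distributions with two atoms above [L] *)

(** The mass function equal to [p] on [1, ..., L], plus mass [x] at [j] and mass
    [y] at [k]. The distributions [G] and [H], and those that show the
    optimality of the lower bound, are all of this form. *)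
Definition two_tail (L : nat) (p : nat -> R) (j : nat) (x : R) (k : nat) (y : R)
  (d : nat) : R :=
  (if andb (Nat.leb 1 d) (Nat.leb d L) then p d else 0)
  + (if Nat.eqb d j then x else 0) + (if Nat.eqb d k then y else 0).

Lemma is_series_two_tail (L : nat) (p : nat -> R) j x k y (a : nat -> R) :
  is_series (fun d => two_tail L p j x k y d * a d)
    (sum_n_m (fun d => p d * a d) 1 L + x * a j + y * a k).
Proof.
apply is_series_ext_R with (2 := is_series_plus _ _ _ _ (is_series_plus _ _ _ _
  (is_series_head (fun d => p d * a d) L) (is_series_point j (x * a j)))
  (is_series_point k (y * a k))).
intros d; change plus with Rplus; unfold two_tail.
destruct (andb _ _), (Nat.eqb_spec d j), (Nat.eqb_spec d k); subst; ring.
Qed.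

Lemma two_tail_low L p j x k y i :
  (L < j)%nat -> (L < k)%nat -> (1 <= i <= L)%nat -> two_tail L p j x k y i = p i.
Proof.
intros Lj Lk Hi; unfold two_tail.
destruct (Nat.leb_spec 1 i), (Nat.leb_spec i L), (Nat.eqb_spec i j),
  (Nat.eqb_spec i k); simpl; try lia; ring.
Qed.

Lemma two_tail_0 L p j x k y :
  (L < j)%nat -> (L < k)%nat -> two_tail L p j x k y 0 = 0.
Proof.
intros Lj Lk; unfold two_tail; simpl.
destruct j, k; simpl; try lia; ring.
Qed.

Lemma two_tail_high L p j x k y d :
  (L < d)%nat -> d <> j -> d <> k -> two_tail L p j x k y d = 0.
Proof.
intros Ld dj dk; unfold two_tail.
destruct (Nat.leb_spec d L), (Nat.eqb_spec d j), (Nat.eqb_spec d k); try lia.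
rewrite Bool.andb_false_r; ring.
Qed.

Lemma two_tail_distr L p j x k y :
  (forall i, (1 <= i <= L)%nat -> 0 <= p i) -> 0 <= x -> 0 <= y ->
  x + y = p_gt L p -> is_distr (two_tail L p j x k y).
Proof.
intros hp x0 y0 xy; split.
- intros d; unfold two_tail.
  assert (0 <= if andb (Nat.leb 1 d) (Nat.leb d L) then p d else 0).
  { destruct (Nat.leb_spec 1 d), (Nat.leb_spec d L); simpl; try lra. now apply hp. }
  destruct (Nat.eqb d j), (Nat.eqb d k); lra.
- unfold p_gt in xy.
  replace 1 with (sum_n_m (fun d => p d * 1) 1 L + x * 1 + y * 1).
  + apply is_series_ext_R with (2 := is_series_two_tail L p j x k y (fun _ => 1)).
    intros d; ring.
  + rewrite (sum_n_m_ext_R _ p) by (intros; ring). lra.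
Qed.

Lemma two_tail_mean L p j x k y :
  has_mean (two_tail L p j x k y)
    (sum_n_m (fun d => INR d * p d) 1 L + x * INR j + y * INR k).
Proof.
unfold has_mean.
rewrite (sum_n_m_ext_R (fun d => INR d * p d) (fun d => p d * INR d))
  by (intros; ring).
apply is_series_ext_R with (2 := is_series_two_tail L p j x k y INR).
intros d; ring.
Qed.

Lemma distr_point_mass (T : nat -> R) (j d : nat) :
  is_distr T -> T j = 1 -> d <> j -> T d = 0.
Proof.
intros [T0 T1] Tj dj.
assert (h : 1 + T d <= 1).
{ apply (is_series_le _ _ _ _) with (2 := is_series_plus _ _ _ _
    (is_series_point j 1) (is_series_point d (T d))) (3 := T1).
  intros e; change plus with Rplus.
  destruct (Nat.eqb_spec e j), (Nat.eqb_spec e d); subst; try lia;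
    try lra. rewrite Rplus_0_r; apply T0. }
specialize (T0 d); lra.
Qed.

(** If the class is non-empty then no candidate for membership is the point mass
    at [2]: mean [2] and [p_1 = 0] force all mass of every member to be at [2]. *)
Lemma degree_class_not_2 (L : nat) (p : nat -> R) (mu : R) (F T : nat -> R) :
  (1 <= L)%nat -> degree_class mu L p F -> is_distr T -> has_mean T mu ->
  (forall i, (1 <= i <= L)%nat -> T i = p i) -> T 2%nat <> 1.
Proof.
intros hL [HF [F0 [F2 [Fm Fp]]]] HT Tm Tp T2.
apply F2.
assert (mu2 : mu = 2).
{ assert (e : is_series (fun d => INR d * T d) 2).
  { apply is_series_ext_R with (2 := is_series_point 2 2).
    intros d; destruct (Nat.eqb_spec d 2) as [-> | d2].
    - rewrite T2; simpl; ring.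
    - rewrite (distr_point_mass T 2 d HT T2 d2); ring. }
  now rewrite <- (is_series_unique _ _ Tm), (is_series_unique _ _ e). }
assert (F1 : F 1%nat = 0).
{ rewrite Fp by lia; rewrite <- Tp by lia. now apply (distr_point_mass T 2). }
apply Rle_antisym.
- apply (is_series_le _ _ _ _) with (2 := is_series_point 2 (F 2%nat)) (3 := proj2 HF).
  intros d; destruct (Nat.eqb_spec d 2) as [-> | _]; [lra | apply HF].
- (* The indicator of 2 is at least 3 - d for every d >= 2, and E[3 - D] = 1. *)
  assert (h := is_series_plus _ _ _ _ (is_series_scal_l 3 _ _ (proj2 HF))
    (is_series_scal_l (-1) _ _ Fm)).
  assert (h' : 3 * 1 + -1 * mu <= F 2%nat); [|lra].
  apply (is_series_le _ _ _ _) with (2 := h) (3 := is_series_point 2 (F 2%nat)).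
  intros d; change (3 * F d + -1 * (INR d * F d) <= if Nat.eqb d 2 then F 2%nat else 0).
  destruct d as [|[|[|d]]]; simpl Nat.eqb; cbv iota.
  + rewrite F0; lra.
  + rewrite F1; lra.
  + simpl; lra.
  + assert (F3 := proj1 HF (S (S (S d)))). rewrite !S_INR.
    assert (d0 := pos_INR d). nra.
Qed.

Lemma two_tail_degree_class (L : nat) (p : nat -> R) (mu : R) j x k y :
  (1 <= L)%nat -> (forall i, (1 <= i <= L)%nat -> 0 <= p i) ->
  (exists F, degree_class mu L p F) ->
  (L < j)%nat -> (L < k)%nat -> 0 <= x -> 0 <= y -> x + y = p_gt L p ->
  x * INR j + y * INR k = mu - sum_n_m (fun d => INR d * p d) 1 L ->
  degree_class mu L p (two_tail L p j x k y).
Proof.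
intros hL hp [F HF] Lj Lk x0 y0 xy m.
assert (HT := two_tail_distr L p j x k y hp x0 y0 xy).
assert (Tm : has_mean (two_tail L p j x k y) mu).
{ replace mu with (sum_n_m (fun d => INR d * p d) 1 L + x * INR j + y * INR k).
  - apply two_tail_mean.
  - rewrite Rplus_assoc, m; ring. }
assert (Tp := fun i => two_tail_low L p j x k y i Lj Lk).
split; [exact HT | split; [now apply two_tail_0 | split; [|now split]]].
now apply (degree_class_not_2 L p mu F).
Qed.

(** [G] has a single atom above [L]; the second atom, at [L + 2], is given mass 0. *)
Lemma G_distE L p d : G_dist L p d = two_tail L p (L + 1) (p_gt L p) (L + 2) 0 d.
Proof.
unfold G_dist, two_tail.
destruct (Nat.eqb_spec d 0), (Nat.leb_spec d L), (Nat.leb_spec 1 d),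
  (Nat.eqb_spec d (L + 1)), (Nat.eqb_spec d (L + 2)); simpl; try lia; ring.
Qed.

Lemma G_dist_distr L p :
  (forall i, (1 <= i <= L)%nat -> 0 <= p i) -> 0 < p_gt L p ->
  is_distr (G_dist L p).
Proof.
intros hp h.
destruct (two_tail_distr L p (L + 1) (p_gt L p) (L + 2) 0 hp) as [T0 T1]; try lra.
split.
- intros d; rewrite G_distE; apply T0.
- apply is_series_ext_R with (2 := T1); intros d; now rewrite G_distE.
Qed.

Lemma is_series_G_dist L p (a : nat -> R) :
  is_series (fun d => G_dist L p d * a d)
    (sum_n_m (fun d => p d * a d) 1 L + p_gt L p * a (L + 1)%nat).
Proof.
replace (_ + _) with
  (sum_n_m (fun d => p d * a d) 1 L + p_gt L p * a (L + 1)%nat + 0 * a (L + 2)%nat)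
  by ring.
apply is_series_ext
  with (2 := is_series_two_tail L p (L + 1) (p_gt L p) (L + 2) 0 a).
intros d; now rewrite G_distE.
Qed.

(** The mean of [G] in closed form, see [G_dist_mean]. *)
Definition mean_G L p : R :=
  sum_n_m (fun d => INR d * p d) 1 L + p_gt L p * INR (L + 1).

Lemma G_dist_mean L p : has_mean (G_dist L p) (mean_G L p).
Proof.
unfold mean_G, has_mean.
rewrite (sum_n_m_ext_R (fun d => INR d * p d) (fun d => p d * INR d))
  by (intros; ring).
apply is_series_ext_R with (2 := is_series_G_dist L p INR).
intros d; ring.
Qed.

Lemma G_dist_low L p i : (1 <= i <= L)%nat -> G_dist L p i = p i.
Proof. intros Hi; rewrite G_distE; apply two_tail_low; lia. Qed.

Lemma G_dist_high L p d : (L + 1 < d)%nat -> G_dist L p d = 0.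
Proof.
intros Hd; unfold G_dist.
destruct (Nat.eqb_spec d 0), (Nat.leb_spec d L), (Nat.eqb_spec d (L + 1));
  try lia; reflexivity.
Qed.

(** * Extremal distributions for a fixed test function *)

(** A sequence that decreases from [L + 1] on has under [G] an expectation at least
    as large as under any member of the class, because [G] puts all its mass
    above [L] at [L + 1]. The means may differ: the sequence is compared with a
    constant, so [beta = 0]. *)
Lemma expectation_le_G (L : nat) (p : nat -> R) (mu : R) (F a : nat -> R) (u v : R) :
  (forall i, (1 <= i <= L)%nat -> 0 <= p i) -> 0 < p_gt L p ->
  degree_class mu L p F ->
  (forall d, (L + 1 <= d)%nat -> a (S d) <= a d) ->
  is_series (fun d => F d * a d) u -> is_series (fun d => G_dist L p d * a d) v ->
  u <= v.
Proof.
intros hp hpL [HF [F0 [_ [Fm Fp]]]] dec Fa Ga.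
apply (expectation_le F (G_dist L p) a mu (mean_G L p) u v (a (L + 1)%nat) 0);
  trivial; [now apply G_dist_distr | apply G_dist_mean | ring |].
intros d. rewrite Rmult_0_l, Rplus_0_r.
destruct (Nat.eq_dec d 0) as [-> | d0]; [rewrite F0; unfold G_dist; simpl; lra|].
destruct (Nat.le_gt_cases d L) as [dL | Ld].
- rewrite Fp, G_dist_low by lia; lra.
- assert (h := decreasing_from a (L + 1) d dec ltac:(lia)).
  assert (Fd := proj1 HF d).
  apply Rle_trans with 0; [nra|].
  destruct (Nat.eq_dec d (L + 1)) as [-> | dL]; [lra|].
  rewrite G_dist_high by lia; lra.
Qed.

Lemma mean_G_le (L : nat) (p : nat -> R) (mu : R) (F : nat -> R) :
  (forall i, (1 <= i <= L)%nat -> 0 <= p i) -> 0 < p_gt L p ->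
  degree_class mu L p F -> mean_G L p <= mu.
Proof.
intros hp hpL HF.
apply Ropp_le_cancel.
assert (h : forall T m, has_mean T m -> is_series (fun d => T d * - INR d) (- m)).
{ intros T m Tm. apply is_series_ext_R with (2 := is_series_opp _ _ Tm).
  intros d; change (- (INR d * T d) = T d * - INR d); ring. }
apply (expectation_le_G L p mu F (fun d => - INR d)); trivial.
- intros d _; rewrite S_INR; lra.
- apply h, HF.
- apply h, G_dist_mean.
Qed.

Lemma mean_G_pos (L : nat) (p : nat -> R) :
  (forall i, (1 <= i <= L)%nat -> 0 <= p i) -> 0 < p_gt L p -> 0 < mean_G L p.
Proof.
intros hp hpL; unfold mean_G.
assert (0 < INR (L + 1)) by (apply lt_0_INR; lia).
assert (0 <= sum_n_m (fun d => INR d * p d) 1 L).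
{ apply (is_series_le (fun _ => 0)) with (3 := is_series_head (fun d => INR d * p d) L).
  - intros d; destruct (Nat.leb_spec 1 d), (Nat.leb_spec d L); simpl; try lra.
    apply Rmult_le_pos; [apply pos_INR | now apply hp].
  - apply is_series_ext_R with (2 := is_series_point 0 0).
    intros d; now destruct (Nat.eqb d 0). }
nra.
Qed.

Lemma kappaE mu L p :
  0 < p_gt L p -> kappa mu L p * p_gt L p = mu - sum_n_m (fun d => INR d * p d) 1 L.
Proof. intros h; unfold kappa; field; lra. Qed.

(** [H] as a member of the class, with atoms at the consecutive integers
    [k = floor kappa] and [k + 1]. *)
Lemma H_distE (L : nat) (p : nat -> R) (mu : R) :
  (1 <= L)%nat -> (forall i, (1 <= i <= L)%nat -> 0 <= p i) -> 0 < p_gt L p ->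
  (exists F, degree_class mu L p F) ->
  exists (k : nat) (x y : R), (L + 1 <= k)%nat /\
    (forall d, H_dist mu L p d = two_tail L p k x (S k) y d) /\
    degree_class mu L p (two_tail L p k x (S k) y).
Proof.
intros hL hp hpL hne.
destruct hne as [F HF].
assert (mG := mean_G_le L p mu F hp hpL HF); unfold mean_G in mG.
assert (kE := kappaE mu L p hpL).
assert (kge : INR (L + 1) <= kappa mu L p)
  by (apply Rmult_le_reg_r with (p_gt L p); lra).
destruct (base_Int_part (kappa mu L p)) as [fl1 fl2].
set (fl := Int_part (kappa mu L p)) in *.
assert (flL : (Z.of_nat L < fl)%Z).
{ apply lt_IZR. rewrite <- INR_IZR_INZ. rewrite plus_INR in kge; simpl in kge; lra. }
assert (flk : fl = Z.of_nat (Z.to_nat fl)) by lia.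
set (k := Z.to_nat fl) in *.
assert (kR : INR k = IZR fl) by (rewrite flk; apply INR_IZR_INZ).
exists k, ((IZR fl + 1 - kappa mu L p) * p_gt L p), ((kappa mu L p - IZR fl) * p_gt L p).
split; [lia | split].
- intros d; unfold H_dist, two_tail; fold fl.
  destruct (Nat.eqb_spec d 0), (Nat.leb_spec d L), (Nat.leb_spec 1 d),
    (Z.eqb_spec (Z.of_nat d) fl), (Z.eqb_spec (Z.of_nat d) (fl + 1)),
    (Nat.eqb_spec d k), (Nat.eqb_spec d (S k)); simpl andb; cbv iota;
    try lia; ring.
- apply two_tail_degree_class; trivial; try lia; try nra.
  + now exists F.
  + rewrite <- kE, S_INR, kR; ring.
Qed.

(** [H] has the smallest expectation, among the members of the class, of
    every sequence that is convex from [L + 1] on. *)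
Lemma expectation_H_le (L : nat) (p : nat -> R) (mu : R) k x y (F a : nat -> R) (u v : R) :
  (L + 1 <= k)%nat ->
  degree_class mu L p (two_tail L p k x (S k) y) -> degree_class mu L p F ->
  (forall d, (L + 1 <= d)%nat -> a (S d) - a d <= a (S (S d)) - a (S d)) ->
  is_series (fun d => two_tail L p k x (S k) y d * a d) u ->
  is_series (fun d => F d * a d) v ->
  u <= v.
Proof.
intros Lk [HT [T0 [_ [Tm Tp]]]] [HF [F0 [_ [Fm Fp]]]] cvx Ta Fa.
(* The affine function through the values of a at k and k + 1. *)
apply (expectation_le (two_tail L p k x (S k) y) F a mu mu u v
  (a k - (a (S k) - a k) * INR k) (a (S k) - a k)); trivial.
intros d.
destruct (Nat.eq_dec d 0) as [-> | d0]; [rewrite F0, T0; lra|].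
destruct (Nat.le_gt_cases d L) as [dL | Ld].
- rewrite Fp, Tp by lia; lra.
- assert (h := convex_supporting_line a (L + 1) k d cvx Lk ltac:(lia)).
  assert (Fd := proj1 HF d).
  apply Rle_trans with 0; [|nra].
  destruct (Nat.eq_dec d k) as [-> | dk]; [lra|].
  destruct (Nat.eq_dec d (S k)) as [-> | dSk]; [rewrite S_INR; lra|].
  rewrite two_tail_high by lia; lra.
Qed.

(** * The lower bound *)

(** The condition on [z_tilde G] passes to [z_tilde_G_mu] because [mean G <= mu]. *)
Lemma z_tilde_G_mu_spec (L : nat) (p : nat -> R) (mu : R) :
  (forall i, (1 <= i <= L)%nat -> 0 <= p i) -> 0 < p_gt L p -> 0 < mu ->
  (exists F, degree_class mu L p F) ->
  is_smallest_solution (fun s => dpgf (G_dist L p) s / mu) (z_tilde_G_mu mu L p) /\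
  z_tilde_G_mu mu L p <= z_tilde (G_dist L p).
Proof.
intros hp hpL hmu [F HF].
assert (HG := G_dist_distr L p hp hpL).
assert (Gm := G_dist_mean L p).
assert (m0 := mean_G_pos L p hp hpL).
assert (mle := mean_G_le L p mu F hp hpL HF).
assert (imu : 0 <= / mu) by now apply Rlt_le, Rinv_0_lt_compat.
destruct (smallest_solution_monotone (fun s => dpgf (G_dist L p) s / mu)) as [Hz _].
- intros s Hs; apply Rmult_le_pos; [|exact imu]. now apply dpgf_ge0 with (mean_G L p).
- intros s t s0 st t1; apply Rmult_le_compat_r; [exact imu|].
  now apply dpgf_le with (mean_G L p).
- rewrite (dpgf_1 _ _ Gm). apply Rle_div_l; lra.
- split; [exact Hz|].
  destruct (z_tilde_fix _ _ HG Gm m0) as [Hz' zE].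
  apply (dpgf_solution_le _ (mean_G L p) mu _ _ HG Gm hmu Hz Hz').
  apply Rle_div_l; [lra|]. nra.
Qed.

Lemma z_tilde_G_mu_fix (L : nat) (p : nat -> R) (mu : R) :
  (forall i, (1 <= i <= L)%nat -> 0 <= p i) -> 0 < p_gt L p -> 0 < mu ->
  (exists F, degree_class mu L p F) ->
  0 <= z_tilde_G_mu mu L p <= 1 /\
  dpgf (G_dist L p) (z_tilde_G_mu mu L p) = mu * z_tilde_G_mu mu L p.
Proof.
intros hp hpL hmu hne.
destruct (z_tilde_G_mu_spec L p mu hp hpL hmu hne) as [[z0 [zE _]] zle].
destruct (z_tilde_fix _ _ (G_dist_distr L p hp hpL) (G_dist_mean L p)
  (mean_G_pos L p hp hpL)) as [[_ zG1] _].
split; [lra|]. rewrite zE at 2. field; lra.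
Qed.

Lemma xi_lower_bound (L : nat) (p : nat -> R) (mu : R) (F : nat -> R) :
  (forall i, (1 <= i <= L)%nat -> 0 <= p i) -> 0 < p_gt L p -> 0 < mu ->
  degree_class mu L p F ->
  z_tilde (G_dist L p) <= exp (- (1 / INR (L + 1))) ->
  1 - pgf (G_dist L p) (z_tilde_G_mu mu L p) <= xi F.
Proof.
intros hp hpL hmu HF hz.
assert (hne : exists F, degree_class mu L p F) by now exists F.
destruct (z_tilde_G_mu_spec L p mu hp hpL hmu hne) as [_ zle].
destruct (z_tilde_G_mu_fix L p mu hp hpL hmu hne) as [z01 zE].
assert (HG := G_dist_distr L p hp hpL).
set (z := z_tilde_G_mu mu L p) in *.
assert (dF := proj1 HF).
assert (Fm : has_mean F mu) by apply HF.
assert (zF : z_tilde F <= z).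
{ apply (z_tilde_le F mu z dF Fm hmu z01). rewrite <- zE.
  apply (expectation_le_G L p mu F (fun d => INR d * z ^ pred d)); trivial.
  - intros d; apply deriv_pow_decreasing; lra.
  - now apply is_series_dpgf with mu.
  - apply is_series_dpgf with (mean_G L p); trivial. apply G_dist_mean. }
destruct (z_tilde_fix F mu dF Fm hmu) as [zF01 _].
assert (h1 := pgf_le F (z_tilde F) z dF ltac:(lra) zF ltac:(lra)).
assert (h2 : pgf F z <= pgf (G_dist L p) z).
{ apply (expectation_le_G L p mu F (fun d => z ^ d)); trivial.
  - intros d _; now apply pow_decreasing.
  - now apply is_series_pgf.
  - now apply is_series_pgf. }
unfold xi; lra.
Qed.

(** Moving a small mass [e] from [L + 1] to a far atom [N] restores the mean [mu]
    and lowers the generating function of [G] and its derivative by at most a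
    multiple of [e]. *)
Lemma exists_near_G (L : nat) (p : nat -> R) (mu delta : R) :
  (1 <= L)%nat -> (forall i, (1 <= i <= L)%nat -> 0 <= p i) -> 0 < p_gt L p ->
  (exists F, degree_class mu L p F) -> 0 < delta ->
  exists (F : nat -> R) (e : R), degree_class mu L p F /\ 0 <= e < delta /\
    forall s, 0 <= s <= 1 ->
      pgf (G_dist L p) s - e <= pgf F s /\
      dpgf (G_dist L p) s - e * INR (L + 1) <= dpgf F s.
Proof.
intros hL hp hpL hne d0.
assert (mle : mean_G L p <= mu)
  by (destruct hne as [F HF]; now apply mean_G_le with F).
set (del := Rmin delta (p_gt L p)).
assert (del0 : 0 < del) by (apply Rmin_glb_lt; lra).
assert (del1 : del <= delta) by apply Rmin_l.
assert (del2 : del <= p_gt L p) by apply Rmin_r.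
destruct (INR_archimed del (mu - mean_G L p) del0) as [n Hn].
set (N := (n + (L + 2))%nat).
set (w := INR n + 1).
assert (NE : INR N = INR (L + 1) + w)
  by (unfold N, w; rewrite !plus_INR; simpl; ring).
assert (n0 := pos_INR n).
set (e := (mu - mean_G L p) / w).
assert (eE : e * w = mu - mean_G L p) by (unfold e, w; field; lra).
assert (e0 : 0 <= e).
{ apply Rmult_le_pos; [lra|]. apply Rlt_le, Rinv_0_lt_compat; unfold w; lra. }
assert (e1 : e < del).
{ apply Rmult_lt_reg_r with w; [unfold w; lra|]. rewrite eE; unfold w; lra. }
assert (HF : degree_class mu L p (two_tail L p (L + 1) (p_gt L p - e) N e)).
{ apply two_tail_degree_class; trivial; try (unfold N; lia); try lra.
  rewrite NE. unfold mean_G in eE. lra. }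
exists (two_tail L p (L + 1) (p_gt L p - e) N e), e.
split; [exact HF | split; [lra|]].
(* Both expectations are explicit: they differ by e * (a N - a (L + 1)). *)
assert (cmp : forall (a : nat -> R) u v c, 0 <= a N -> a (L + 1)%nat <= c ->
  is_series (fun d => G_dist L p d * a d) u ->
  is_series (fun d => two_tail L p (L + 1) (p_gt L p - e) N e d * a d) v ->
  u - e * c <= v).
{ intros a u v c aN aL Hu Hv.
  rewrite <- (is_series_unique _ _ Hu), <- (is_series_unique _ _ Hv).
  rewrite (is_series_unique _ _ (is_series_G_dist L p a)),
    (is_series_unique _ _ (is_series_two_tail L p _ _ _ _ a)).
  assert (h1 := Rmult_le_compat_l e _ _ e0 aL).
  assert (h2 := Rmult_le_pos _ _ e0 aN). lra. }
intros s Hs; split.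
- rewrite <- (Rmult_1_r e) at 1.
  apply (cmp (fun d => s ^ d)).
  + now apply pow_01.
  + now apply pow_01.
  + apply is_series_pgf; trivial. now apply G_dist_distr.
  + apply is_series_pgf; trivial. apply HF.
- apply (cmp (fun d => INR d * s ^ pred d)).
  + apply Rmult_le_pos; [apply pos_INR | now apply pow_01].
  + rewrite <- (Rmult_1_r (INR (L + 1))) at 2.
    apply Rmult_le_compat_l; [apply pos_INR | now apply pow_01].
  + apply is_series_dpgf with (mean_G L p); trivial;
      [now apply G_dist_distr | apply G_dist_mean].
  + apply is_series_dpgf with mu; trivial; apply HF.
Qed.

(** By convexity, [g_G'(s) / mu - s] is at least its value at [t] for all
    [s <= t < z]; so its smallest zero [z] can only move a little to the left under
    a small perturbation of [g_G']. *)
Lemma xi_lower_bound_sharp (L : nat) (p : nat -> R) (mu eta : R) :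
  (1 <= L)%nat -> (forall i, (1 <= i <= L)%nat -> 0 <= p i) -> 0 < p_gt L p ->
  0 < mu -> (exists F, degree_class mu L p F) -> 0 < eta ->
  exists F, degree_class mu L p F /\
    xi F <= 1 - pgf (G_dist L p) (z_tilde_G_mu mu L p) + (mean_G L p + 1) * eta.
Proof.
intros hL hp hpL hmu hne eta0.
destruct (z_tilde_G_mu_spec L p mu hp hpL hmu hne) as [Hz _].
destruct (z_tilde_G_mu_fix L p mu hp hpL hmu hne) as [z01 zE].
assert (HG := G_dist_distr L p hp hpL).
assert (Gm := G_dist_mean L p).
assert (mG := mean_G_pos L p hp hpL).
set (z := z_tilde_G_mu mu L p) in *.
assert (Lp : 0 < INR (L + 1)) by (apply lt_0_INR; lia).
set (t := z - eta).
set (c := dpgf (G_dist L p) t - mu * t).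
assert (c0 : 0 <= t -> 0 < c).
{ intros t0. apply Rnot_le_lt; intros cle.
  assert (z <= t); [|unfold t in *; lra].
  apply (dpgf_solution_le _ _ mu _ _ HG Gm hmu Hz); [unfold t in *; lra|].
  apply Rle_div_l; unfold c in cle; lra. }
assert (gap : forall s, 0 <= s -> s <= t -> c <= dpgf (G_dist L p) s - mu * s).
{ intros s s0 st.
  assert (cv := dpgf_convex _ _ s t z HG Gm s0 st ltac:(unfold t; lra) ltac:(lra)).
  rewrite zE in cv. assert (c0' := c0 ltac:(lra)).
  assert (h : (z - s) * c <= (z - t) * (dpgf (G_dist L p) s - mu * s)) by (unfold c; lra).
  assert (zt : 0 < z - t) by (unfold t; lra).
  apply Rmult_le_reg_l with (z - t); [exact zt|]. nra. }
assert (hd : exists delta, 0 < delta /\ delta <= eta /\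
               (0 <= t -> delta * INR (L + 1) <= c)).
{ destruct (Rle_dec 0 t) as [t0 | t0].
  - exists (Rmin eta (c / INR (L + 1))); split; [|split].
    + apply Rmin_glb_lt; [lra|]. apply Rdiv_lt_0_compat; auto.
    + apply Rmin_l.
    + intros _. apply Rle_trans with (c / INR (L + 1) * INR (L + 1)).
      * apply Rmult_le_compat_r; [lra | apply Rmin_r].
      * right; field; lra.
  - exists eta; split; [lra | split; [lra | intros; lra]]. }
destruct hd as [delta [d0 [deta dc]]].
destruct (exists_near_G L p mu delta hL hp hpL hne d0) as [F [e [HF [[e0 e1] near]]]].
exists F; split; [exact HF|].
destruct (z_tilde_fix F mu (proj1 HF) ltac:(apply HF) hmu) as [zF01 zFE].
set (zF := z_tilde F) in *.
assert (tz : t <= zF).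
{ apply Rnot_lt_le; intros zt.
  assert (g := gap zF (proj1 zF01) ltac:(lra)).
  destruct (near zF zF01) as [_ nr].
  assert (dc' := dc ltac:(lra)).
  assert (e * INR (L + 1) < delta * INR (L + 1)) by now apply Rmult_lt_compat_r.
  lra. }
assert (lip : pgf (G_dist L p) z - mean_G L p * eta <= pgf (G_dist L p) zF).
{ destruct (Rle_dec zF z) as [zz | zz].
  - assert (l := pgf_lipschitz _ _ zF z HG Gm ltac:(lra) zz ltac:(lra)).
    unfold t in tz. nra.
  - assert (l := pgf_le _ z zF HG ltac:(lra) ltac:(lra) ltac:(lra)). nra. }
destruct (near zF zF01) as [nr _].
unfold xi; fold zF. lra.
Qed.

(** * The upper bound *)

Lemma xi_upper_bound (L : nat) (p : nat -> R) (mu : R) k x y (F : nat -> R) :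
  0 < mu -> (L + 1 <= k)%nat ->
  degree_class mu L p (two_tail L p k x (S k) y) -> degree_class mu L p F ->
  z_tilde (two_tail L p k x (S k) y) <= exp (- (2 / INR (L + 1))) ->
  xi F <= xi (two_tail L p k x (S k) y).
Proof.
intros hmu Lk HT HF hz.
set (T := two_tail L p k x (S k) y) in *.
assert (dT := proj1 HT).
assert (Tm : has_mean T mu) by apply HT.
assert (dF := proj1 HF).
assert (Fm : has_mean F mu) by apply HF.
destruct (z_tilde_fix T mu dT Tm hmu) as [zT01 _].
destruct (z_tilde_fix F mu dF Fm hmu) as [zF01 zFE].
assert (zz : z_tilde T <= z_tilde F).
{ destruct (Rle_dec (z_tilde T) (z_tilde F)) as [h | h]; [exact h|].
  apply (z_tilde_le T mu _ dT Tm hmu zF01). rewrite <- zFE.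
  apply (expectation_H_le L p mu k x y F
    (fun d => INR d * z_tilde F ^ pred d)); trivial.
  - intros d; apply deriv_pow_convex; lra.
  - now apply is_series_dpgf with mu.
  - now apply is_series_dpgf with mu. }
assert (h1 := pgf_le F _ _ dF (proj1 zT01) zz (proj2 zF01)).
assert (h2 : pgf T (z_tilde T) <= pgf F (z_tilde T)).
{ apply (expectation_H_le L p mu k x y F (fun d => z_tilde T ^ d)); trivial.
  - intros d _; now apply pow_seq_convex.
  - now apply is_series_pgf.
  - now apply is_series_pgf. }
unfold xi; lra.
Qed.

Theorem theorem1p1 (L : nat) (p : nat -> R) (mu : R)
  (hL : (1 <= L)%nat)
  (hp : forall i, (1 <= i <= L)%nat -> 0 <= p i)
  (hpL : 0 < p_gt L p)
  (hmu : 0 < mu)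
  (hne : exists F, degree_class mu L p F) :
  (z_tilde (G_dist L p) <= exp (- (1 / INR (L + 1))) ->
     (forall F, degree_class mu L p F ->
        xi F >= 1 - pgf (G_dist L p) (z_tilde_G_mu mu L p)) /\
     Glb_Rbar (fun x => exists F, degree_class mu L p F /\ x = xi F)
       = Finite (1 - pgf (G_dist L p) (z_tilde_G_mu mu L p)))
  /\
  (z_tilde (H_dist mu L p) <= exp (- (2 / INR (L + 1))) ->
     (forall F, degree_class mu L p F -> xi F <= xi (H_dist mu L p)) /\
     Lub_Rbar (fun x => exists F, degree_class mu L p F /\ x = xi F)
       = Finite (xi (H_dist mu L p))).
Proof.
split; intros hz.
- assert (lower : forall F, degree_class mu L p F ->
    1 - pgf (G_dist L p) (z_tilde_G_mu mu L p) <= xi F)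
    by (intros F HF; now apply xi_lower_bound).
  split; [intros F HF; now apply Rle_ge, lower|].
  apply is_glb_Rbar_unique; split.
  + intros x [F [HF ->]]; now apply lower.
  + intros b hb.
    assert (mG := mean_G_pos L p hp hpL).
    assert (hb' : forall eta, 0 < eta -> Rbar_le b
      (1 - pgf (G_dist L p) (z_tilde_G_mu mu L p) + eta)).
    { intros eta eta0.
      destruct (xi_lower_bound_sharp L p mu (eta / (mean_G L p + 1)))
        as [F [HF hF]]; trivial.
      - apply Rdiv_lt_0_compat; lra.
      - apply Rbar_le_trans with (xi F); [apply hb; now exists F|].
        replace ((mean_G L p + 1) * (eta / (mean_G L p + 1))) with eta in hF
          by (field; lra).
        exact hF. }
    destruct b as [b | |]; [|exact (hb' 1 Rlt_0_1)|exact I].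
    apply le_epsilon; exact hb'.
- destruct (H_distE L p mu hL hp hpL hne) as [k [x [y [Lk [HE HT]]]]].
  rewrite (FunctionalExtensionality.functional_extensionality _ _ HE) in hz |- *.
  assert (upper := fun F HF => xi_upper_bound L p mu k x y F hmu Lk HT HF hz).
  split; [exact upper|].
  apply is_lub_Rbar_unique; split.
  + intros r [F [HF ->]]; now apply upper.
  + intros b hb; apply hb. now exists (two_tail L p k x (S k) y).
Qed.
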